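(* Let $X$ be a twisted virtual bikeigebra, and let $D$ and $D'$ be twisted virtual handlebody-link diagrams related by a finite sequence of twisted virtual handlebody-link Reidemeister moves. Then $\Phi_X^{\mathbb{Z}}(D)=\Phi_X^{\mathbb{Z}}(D')$. In particular, $\Phi_X^{\mathbb{Z}}$ is an invariant of twisted virtual handlebody-links.
   Context: **Diagrams.** A twisted virtual handlebody-link diagram is an unoriented planar diagram of a trivalent graph (circle components without vertices are allowed) whose double points are each either a classical crossing (with over/under information) or a virtual crossing (no over/under information), and whose edges may carry finitely many twist bars (marked points away from crossings and vertices). The semiarcs of a diagram are the pieces obtained by cutting it at all vertices, all twist bars and all classical and virtual crossings (at a crossing both strands are cut); a circle component with no such points is a single semiarc. **Reidemeister moves.** Up to planar isotopy, the moves are the following local replacements, in either direction. - rI: add or remove a kink with one classical crossing (either sign). - rII: add or remove a bigon between two strands with two classical crossings, one strand being over at both. - rIII: the classical triangle move with three classical crossings (a strand moves over, under or between the two strands of a classical crossing, in the usual way). - vI, vII, vIII: the same three moves with all crossings virtual. - v: a strand meeting the two strands of a classical crossing only in virtual crossings is moved across that classical crossing. - rIV: two edges adjacent at a vertex which cross each other once classically (either choice of over/under) next to the vertex are untwisted, removing the crossing. - rV: a strand crossing over one edge at a vertex (respectively, under) is moved across the vertex so that it crosses over (respectively, under) the other two edges. - rVI (IH-move): an edge joining two distinct vertices and carrying no crossings or bars, with four outer ends $a,b,c,d$ in cyclic order, whose two vertices join $a,b$ and $c,d$ respectively, is replaced by an edge whose two vertices join $b,c$ and $d,a$ respectively. -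 tI: two consecutive twist bars on an edge are added or removed. - tII: a twist bar is moved along its strand through a virtual crossing. - tIII: a classical crossing between two strands with a twist bar on each of its four ends is replaced by three consecutive crossings between the two strands, virtual, classical, virtual, with no twist bars, where the strand that was under at the original classical crossing is over at the new one. - tIV: a vertex with a twist bar on each of its three edges is replaced by a vertex without twist bars, two adjacent edges of which cross each other once virtually next to the vertex. - tV: a strand crossing one edge at a vertex virtually is moved across the vertex so that it crosses the other two edges virtually. Twisted virtual handlebody-links are equivalence classes of diagrams under these moves. **Twisted virtual bikeigebras.** A twisted virtual bikeigebra is a set $X$ with three binary operations $\underline{\ast},\overline{\ast},\circledast: X\times X\to X$, a partially defined binary operation $(x,y)\mapsto xy$, and an involution $T:X\to X$ (so $T\circ T=\mathrm{id}$), satisfying the following. (i) For all $x$: $x\,\underline{\ast}\,x=x\,\overline{\ast}\,x$. (ii) For all $x,y$: $(x\,\underline{\ast}\,y)\,\underline{\ast}\,y=x$; $(x\,\overline{\ast}\,y)\,\overline{\ast}\,y=x$; $x\,\underline{\ast}\,(y\,\overline{\ast}\,x)=x\,\underline{\ast}\,y$; $x\,\overline{\ast}\,(y\,\underline{\ast}\,x)=x\,\overline{\ast}\,y$; $(x\circledast y)\circledast y=x$; $x\circledast(y\circledast x)=x\circledast y$. (iii) For all $x,y,z$: $(x\,\underline{\ast}\,y)\,\underline{\ast}\,(z\,\underline{\ast}\,y)=(x\,\underline{\ast}\,z)\,\underline{\ast}\,(y\,\overline{\ast}\,z)$; $(x\,\underline{\ast}\,y)\,\overline{\ast}\,(z\,\underline{\ast}\,y)=(x\,\overline{\ast}\,z)\,\underline{\ast}\,(y\,\overline{\ast}\,z)$;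 $(x\,\overline{\ast}\,y)\,\overline{\ast}\,(z\,\overline{\ast}\,y)=(x\,\overline{\ast}\,z)\,\overline{\ast}\,(y\,\underline{\ast}\,z)$; $(x\,\underline{\ast}\,y)\circledast(z\circledast y)=(x\circledast z)\,\underline{\ast}\,(y\circledast z)$; $(x\,\overline{\ast}\,y)\circledast(z\circledast y)=(x\circledast z)\,\overline{\ast}\,(y\circledast z)$; $(x\circledast y)\circledast(z\,\overline{\ast}\,y)=(x\circledast z)\circledast(y\,\underline{\ast}\,z)$; $(x\circledast y)\circledast(z\circledast y)=(x\circledast z)\circledast(y\circledast z)$. (iv) Where the partial product is defined, it is associative, $xy=z\iff yz=x\iff zx=y$, and $xy=(y\,\overline{\ast}\,x)(x\,\underline{\ast}\,y)$; $xy=(y\,\underline{\ast}\,x)(x\,\overline{\ast}\,y)$; $(xy)\,\underline{\ast}\,z=(x\,\underline{\ast}\,z)(y\,\underline{\ast}\,(z\,\overline{\ast}\,x))$; $(xy)\,\overline{\ast}\,z=(x\,\overline{\ast}\,z)(y\,\overline{\ast}\,(z\,\underline{\ast}\,x))$; $(xy)\circledast z=(x\circledast z)(y\circledast(z\circledast x))$; $x\,\underline{\ast}\,(yz)=(x\,\underline{\ast}\,y)\,\underline{\ast}\,z$; $x\,\overline{\ast}\,(yz)=(x\,\overline{\ast}\,y)\,\overline{\ast}\,z$; $x\circledast(yz)=(x\circledast y)\circledast z$. (v) For all $x,y$: $T(x\circledast y)=T(x)\circledast y$; $x\circledast y=x\circledast T(y)$; $T(T(x)T(y))=(y\circledast x)(x\circledast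 y)$; $T(T(x)\,\underline{\ast}\,T(y))=[(x\circledast y)\,\overline{\ast}\,(y\circledast x)]\circledast[(y\circledast x)\,\underline{\ast}\,(x\circledast y)]$; $T(T(x)\,\overline{\ast}\,T(y))=[(x\circledast y)\,\underline{\ast}\,(y\circledast x)]\circledast[(y\circledast x)\,\overline{\ast}\,(x\circledast y)]$. Convention on partial products: ''$xy=z$'' means that $xy$ is defined and equals $z$. An equation between two expressions both involving partial products (including associativity $(xy)z=x(yz)$) means that one side is defined if and only if the other is, and then they are equal. The three equations of the form $x\ast(yz)=(x\ast y)\ast z$ are required whenever $yz$ is defined. **Colorings.** An $X$-coloring of a diagram $D$ is an assignment of an element of $X$ to each semiarc of $D$ such that: - at each classical crossing whose under strand has its two semiarcs colored $a,a'$ and whose over strand has its two semiarcs colored $b,b'$, we have $a'=a\,\underline{\ast}\,b$ and $b'=b\,\overline{\ast}\,a$ (by axiom (ii) this does not depend on which semiarc of each strand is called unprimed); - at each virtual crossing whose strands have semiarcs colored $a,a'$ and $b,b'$, we have $a'=a\circledast b$ and $b'=b\circledast a$ (again independent of choices); - at each twist bar the semiarcs on the two sides are colored $x$ and $T(x)$ for some $x\in X$; - at each vertex whose three incident semiarc ends are colored $x,y,z$ in clockwise order, the product $xy$ is defined and $xy=z$ (independent of the starting semiarc by axiom (iv)). $\mathcal{C}(D,X)$ denotes the set of $X$-colorings of $D$, and $\Phi_X^{\mathbb{Z}}(D)=|\mathcal{C}(D,X)|$ denotes its cardinality. *)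

(* Defs.v *)
From mathcomp Require Import all_boot generic_quotient.
From mathcomp Require Import boolp classical_sets functions cardinality.
From Stdlib Require Import Relation_Operators.

Set Implicit Arguments.
Unset Strict Implicit.
Unset Printing Implicit Defensive.

(** * Twisted virtual bikeigebras *)

Reserved Notation "x *_ y" (at level 40, left associativity).
Reserved Notation "x *^ y" (at level 40, left associativity).
Reserved Notation "x *@ y" (at level 40, left associativity).
Reserved Notation "x *? y" (at level 40, left associativity).

(* [x *_ y], [x *^ y] and [x *@ y] are the under, over and circled operations.
   The partial product is [x *? y : option X]: [None] means "undefined", and
   [x *? y = Some z] means "xy is defined and equals z".  An equality in
   [option X] is thus exactly an equation between partially defined
   expressions: one side is defined iff the other one is, and then they agree. *)
Record tvBikeigebra : Type := TVBikeigebra {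
  carrier :> Type;
  under_op : carrier -> carrier -> carrier
    where "x *_ y" := (under_op x y);
  over_op : carrier -> carrier -> carrier
    where "x *^ y" := (over_op x y);
  virt_op : carrier -> carrier -> carrier
    where "x *@ y" := (virt_op x y);
  pprod : carrier -> carrier -> option carrier
    where "x *? y" := (pprod x y);
  twist : carrier -> carrier;

  twistK : forall x, twist (twist x) = x;

  bk_diag : forall x, x *_ x = x *^ x;

  bk_underK : forall x y, (x *_ y) *_ y = x;
  bk_overK : forall x y, (x *^ y) *^ y = x;
  bk_under_over : forall x y, x *_ (y *^ x) = x *_ y;
  bk_over_under : forall x y, x *^ (y *_ x) = x *^ y;
  bk_virtK : forall x y, (x *@ y) *@ y = x;
  bk_virt_virt : forall x y, x *@ (y *@ x) = x *@ y;

  bk_uuu : forall x y z, (x *_ y) *_ (z *_ y) = (x *_ z) *_ (y *^ z);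
  bk_uou : forall x y z, (x *_ y) *^ (z *_ y) = (x *^ z) *_ (y *^ z);
  bk_ooo : forall x y z, (x *^ y) *^ (z *^ y) = (x *^ z) *^ (y *_ z);
  bk_uvv : forall x y z, (x *_ y) *@ (z *@ y) = (x *@ z) *_ (y *@ z);
  bk_ovv : forall x y z, (x *^ y) *@ (z *@ y) = (x *@ z) *^ (y *@ z);
  bk_vvo : forall x y z, (x *@ y) *@ (z *^ y) = (x *@ z) *@ (y *_ z);
  bk_vvv : forall x y z, (x *@ y) *@ (z *@ y) = (x *@ z) *@ (y *@ z);

  bk_prodA : forall x y z,
    obind (fun xy => xy *? z) (x *? y) = obind (fun yz => x *? yz) (y *? z);
  bk_prod_rot1 : forall x y z, x *? y = Some z <-> y *? z = Some x;
  bk_prod_rot2 : forall x y z, y *? z = Some x <-> z *? x = Some y;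
  bk_prod_ou : forall x y, x *? y = (y *^ x) *? (x *_ y);
  bk_prod_uo : forall x y, x *? y = (y *_ x) *? (x *^ y);
  bk_prod_under : forall x y z,
    omap (fun xy => xy *_ z) (x *? y) = (x *_ z) *? (y *_ (z *^ x));
  bk_prod_over : forall x y z,
    omap (fun xy => xy *^ z) (x *? y) = (x *^ z) *? (y *^ (z *_ x));
  bk_prod_virt : forall x y z,
    omap (fun xy => xy *@ z) (x *? y) = (x *@ z) *? (y *@ (z *@ x));
  bk_under_prod : forall x y z yz, y *? z = Some yz ->
    x *_ yz = (x *_ y) *_ z;
  bk_over_prod : forall x y z yz, y *? z = Some yz ->
    x *^ yz = (x *^ y) *^ z;
  bk_virt_prod : forall x y z yz, y *? z = Some yz ->
    x *@ yz = (x *@ y) *@ z;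

  bk_twist_virt : forall x y, twist (x *@ y) = twist x *@ y;
  bk_virt_twist : forall x y, x *@ y = x *@ twist y;
  bk_twist_prod : forall x y,
    omap twist (twist x *? twist y) = (y *@ x) *? (x *@ y);
  bk_twist_under : forall x y,
    twist (twist x *_ twist y)
      = ((x *@ y) *^ (y *@ x)) *@ ((y *@ x) *_ (x *@ y));
  bk_twist_over : forall x y,
    twist (twist x *^ twist y)
      = ((x *@ y) *_ (y *@ x)) *@ ((y *@ x) *^ (x *@ y))
}.

Notation "x *_ y" := (under_op x y).
Notation "x *^ y" := (over_op x y).
Notation "x *@ y" := (virt_op x y).
Notation "x *? y" := (pprod x y).

(** * Diagrams *)

(* A planar diagram is put in general position with respect to the height
   function and read from bottom to top: it is cut by horizontal lines into
   slices, each containing a single elementary piece, with vertical strands to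
   its left and to its right.  Planar isotopy is the equivalence relation
   generated by the relation [isotopy] below, applied inside any diagram: these
   are the usual generators for planar isotopy of diagrams in general position
   (straightening of zigzags, height exchange of distant pieces, and rotation of
   crossings, bars and vertices). *)

(* At a crossing, one strand runs from bottom left to top right (the rising
   strand) and the other one from bottom right to top left; the rising strand
   is over in [Classical true] and under in [Classical false]. *)
Inductive crossing := Classical of bool | Virtual.

Definition flip (t : crossing) : crossing :=
  if t is Classical b then Classical (~~ b) else Virtual.

(* [Cup] is a local minimum and [Cap] a local maximum of a strand.  [Split] is
   a trivalent vertex with one edge below and two above, [Merge] one with two
   edges below and one above. *)
Inductive piece := Cup | Cap | Cross of crossing | Bar | Split | Merge.

Definition ends_below (g : piece) : nat :=
  match g with
  | Cup => 0 | Cap => 2 | Cross _ => 2 | Bar => 1 | Split => 1 | Merge => 2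
  end.

Definition ends_above (g : piece) : nat :=
  match g with
  | Cup => 2 | Cap => 0 | Cross _ => 2 | Bar => 1 | Split => 2 | Merge => 1
  end.

(* [Slice l g r] is the piece [g] with [l] vertical strands to its left and [r]
   vertical strands to its right. *)
Record slice := Slice { lft : nat; elt : piece; rgt : nat }.

Definition below (s : slice) : nat := lft s + ends_below (elt s) + rgt s.
Definition above (s : slice) : nat := lft s + ends_above (elt s) + rgt s.

Fixpoint tangle (m : nat) (w : seq slice) (n : nat) : bool :=
  if w is s :: w' then (below s == m) && tangle (above s) w' n else m == n.

Record diagram := Diagram { slices :> seq slice; slicesP : tangle 0 slices 0 }.

(** * Semiarcs *)

(* Level [i] is the horizontal line just below slice number [i]; the last level
   is above all slices. *)
Definition width (D : diagram) (i : nat) : nat :=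
  nth 0 (0 :: [seq above s | s <- D]) i.

(* The points where the diagram meets the levels: the tag is the level, and the
   value is the position on it, counted from the left.  Every semiarc contains
   such a point. *)
Definition level_point (D : diagram) : Type :=
  {i : 'I_(size D).+1 & 'I_(width D i)}.

Definition mk_level_point (D : diagram) (i : 'I_(size D).+1)
    (j : 'I_(width D i)) : level_point D :=
  Tagged (fun i : 'I_(size D).+1 => 'I_(width D i)) j.

(* The points at positions [(i, j)] and [(i', j')] are joined by an arc of
   slice [s], located between levels [k] and [k.+1], that contains no vertex,
   bar or crossing. *)
Definition joined_in (s : slice) (k i j i' j' : nat) : bool :=
  [|| [&& i == k, i' == k.+1, j < lft s & j' == j],
      [&& i == k, i' == k.+1, lft s + ends_below (elt s) <= j
        & j' + ends_below (elt s) == j + ends_above (elt s)],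
      (if elt s is Cup then
         [&& i == k.+1, i' == k.+1, j == lft s & j' == (lft s).+1]
       else false)
    | (if elt s is Cap then
         [&& i == k, i' == k, j == lft s & j' == (lft s).+1]
       else false)].

Definition joined (D : diagram) (p q : level_point D) : bool :=
  [exists k : 'I_(size D),
     joined_in (nth (Slice 0 Cup 0) D k) k
       (tag p) (tagged p) (tag q) (tagged q)].

Definition link (D : diagram) (p q : level_point D) : bool :=
  joined p q || joined q p.

Definition same_semiarc (D : diagram) : rel (level_point D) := connect (@link D).

Lemma same_semiarc_refl D : reflexive (@same_semiarc D).
Proof. exact: connect0. Qed.

Lemma same_semiarc_sym D : symmetric (@same_semiarc D).
Proof.
by apply: sym_connect_sym => p q; rewrite /link orbC.
Qed.

Lemma same_semiarc_trans D : transitive (@same_semiarc D).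
Proof. exact: connect_trans. Qed.

Canonical same_semiarc_equiv (D : diagram) :=
  EquivRel (@same_semiarc D) (@same_semiarc_refl D) (@same_semiarc_sym D)
    (@same_semiarc_trans D).

Definition semiarc (D : diagram) : Type := {eq_quot @same_semiarc D}%qT.

Definition semiarc_of (D : diagram) (p : level_point D) : semiarc D :=
  (\pi_({eq_quot @same_semiarc D}%qT) p)%qT.

(** * Colorings *)

(* [bl], [br], [tl], [tr] are the colors at the bottom left, bottom right, top
   left and top right of the crossing. *)
Definition crossing_rule (X : tvBikeigebra) (t : crossing) (bl br tl tr : X) :
    Prop :=
  match t with
  | Classical true => tl = br *_ bl /\ tr = bl *^ br
  | Classical false => tr = bl *_ br /\ tl = br *^ bl
  | Virtual => tr = bl *@ br /\ tl = br *@ bl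
  end.

(* [bot] and [top] list the colors of the ends of a piece on its lower and
   upper sides, from left to right.  Clockwise, the edges at a vertex are top
   left, top right, bottom for [Split], and top, bottom right, bottom left for
   [Merge].  Cups and caps impose nothing, as both of their ends belong to the
   same semiarc. *)
Definition piece_rule (X : tvBikeigebra) (g : piece) (bot top : seq X) : Prop :=
  match g, bot, top with
  | Cup, [::], [:: _; _] => True
  | Cap, [:: _; _], [::] => True
  | Cross t, [:: bl; br], [:: tl; tr] => crossing_rule t bl br tl tr
  | Bar, [:: b], [:: t] => exists x : X,
      (b = x /\ t = twist x) \/ (b = twist x /\ t = x)
  | Split, [:: b], [:: tl; tr] => tl *? tr = Some b
  | Merge, [:: bl; br], [:: t] => t *? br = Some bl
  | _, _, _ => False
  end.

Definition level_colors (X : Type) (D : diagram) (f : semiarc D -> X)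
    (i : 'I_(size D).+1) : seq X :=
  [seq f (semiarc_of (mk_level_point j)) | j <- enum 'I_(width D i)].

Definition is_coloring (X : tvBikeigebra) (D : diagram) (f : semiarc D -> X) :
    Prop :=
  forall k : 'I_(size D),
    let s := nth (Slice 0 Cup 0) D k in
    let bot := level_colors f (widen_ord (leqnSn (size D)) k) in
    let top := level_colors f (lift ord0 k) in
    piece_rule (elt s)
      (take (ends_below (elt s)) (drop (lft s) bot))
      (take (ends_above (elt s)) (drop (lft s) top)).

Definition colorings (X : tvBikeigebra) (D : diagram) : set (semiarc D -> X) :=
  [set f | is_coloring f]%classic.
Arguments colorings : clear implicits.

(** * Planar isotopy and Reidemeister moves *)

(* The constructors of [isotopy] and [reidemeister] give local pictures in one
   position; a local picture may be bent into any other position in the plane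
   using [isotopy]. *)
Inductive isotopy : seq slice -> seq slice -> Prop :=
| iso_zigzag_l :
    isotopy [:: Slice 1 Cup 0; Slice 0 Cap 1] [::]
| iso_zigzag_r :
    isotopy [:: Slice 0 Cup 1; Slice 1 Cap 0] [::]
(* pieces that are horizontally apart change heights *)
| iso_exchange (g h : piece) (m : nat) :
    isotopy
      [:: Slice 0 g (m + ends_below h); Slice (ends_above g + m) h 0]
      [:: Slice (ends_below g + m) h 0; Slice 0 g (m + ends_above h)]
(* a strand crosses the left or the right side of a local extremum *)
| iso_cross_cap (t : crossing) :
    isotopy
      [:: Slice 1 (Cross t) 0; Slice 0 Cap 1]
      [:: Slice 0 (Cross (flip t)) 1; Slice 1 Cap 0]
| iso_cross_cup (t : crossing) :
    isotopy
      [:: Slice 1 Cup 0; Slice 0 (Cross t) 1]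
      [:: Slice 0 Cup 1; Slice 1 (Cross (flip t)) 0]
| iso_bar_cap :
    isotopy
      [:: Slice 0 Bar 1; Slice 0 Cap 0]
      [:: Slice 1 Bar 0; Slice 0 Cap 0]
| iso_bar_cup :
    isotopy
      [:: Slice 0 Cup 0; Slice 0 Bar 1]
      [:: Slice 0 Cup 0; Slice 1 Bar 0]
(* an edge at a vertex is bent *)
| iso_split_cap_l :
    isotopy [:: Slice 1 Split 0; Slice 0 Cap 1] [:: Slice 0 Merge 0]
| iso_split_cap_r :
    isotopy [:: Slice 0 Split 1; Slice 1 Cap 0] [:: Slice 0 Merge 0]
| iso_cup_merge_l :
    isotopy [:: Slice 0 Cup 1; Slice 1 Merge 0] [:: Slice 0 Split 0]
| iso_cup_merge_r :
    isotopy [:: Slice 1 Cup 0; Slice 0 Merge 1] [:: Slice 0 Split 0].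

Definition kink (t : crossing) : seq slice :=
  [:: Slice 1 Cup 0; Slice 0 (Cross t) 1; Slice 1 Cap 0].

(* The crossings of two strands that run in parallel, such that the same strand
   is over at both when they are classical. *)
Definition bigon (t : crossing) : seq slice :=
  [:: Slice 0 (Cross t) 0; Slice 0 (Cross (flip t)) 0].

(* Numbering three strands from left to right at the bottom, [t12], [t13] and
   [t23] are the types of the crossings between them. *)
Definition triangle_l (t12 t13 t23 : crossing) : seq slice :=
  [:: Slice 0 (Cross t12) 1; Slice 1 (Cross t13) 0; Slice 0 (Cross t23) 1].
Definition triangle_r (t12 t13 t23 : crossing) : seq slice :=
  [:: Slice 1 (Cross t23) 0; Slice 0 (Cross t13) 1; Slice 1 (Cross t12) 0].

(* A transversal strand crosses the lower edge of a vertex, respectively its two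
   upper edges; in both cases it is the rising strand at its crossings. *)
Definition pass_one_edge (t : crossing) : seq slice :=
  [:: Slice 0 (Cross t) 0; Slice 0 Split 1].
Definition pass_two_edges (t : crossing) : seq slice :=
  [:: Slice 1 Split 0; Slice 0 (Cross t) 1; Slice 1 (Cross t) 0].

Inductive reidemeister : seq slice -> seq slice -> Prop :=
| move_rI (b : bool) :
    reidemeister (kink (Classical b)) [::]
| move_rII (b : bool) :
    reidemeister (bigon (Classical b)) [::]
(* The excluded cases, [b12 = b23] distinct from [b13], are those in which each
   of the three strands is over another one; in all other cases one strand is
   on top, one in the middle and one at the bottom. *)
| move_rIII (b12 b13 b23 : bool) :
    (b12 == b13) || (b13 == b23) ->
    reidemeister
      (triangle_l (Classical b12) (Classical b13) (Classical b23))
      (triangle_r (Classical b12) (Classical b13) (Classical b23))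
| move_vI :
    reidemeister (kink Virtual) [::]
| move_vII :
    reidemeister (bigon Virtual) [::]
| move_vIII :
    reidemeister
      (triangle_l Virtual Virtual Virtual)
      (triangle_r Virtual Virtual Virtual)
| move_v12 (b : bool) :
    reidemeister
      (triangle_l (Classical b) Virtual Virtual)
      (triangle_r (Classical b) Virtual Virtual)
| move_v13 (b : bool) :
    reidemeister
      (triangle_l Virtual (Classical b) Virtual)
      (triangle_r Virtual (Classical b) Virtual)
| move_v23 (b : bool) :
    reidemeister
      (triangle_l Virtual Virtual (Classical b))
      (triangle_r Virtual Virtual (Classical b))
| move_rIV (b : bool) :
    reidemeister
      [:: Slice 0 Split 0; Slice 0 (Cross (Classical b)) 0]
      [:: Slice 0 Split 0]
| move_rV (b : bool) :
    reidemeister (pass_one_edge (Classical b)) (pass_two_edges (Classical b))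
| move_rVI :
    reidemeister
      [:: Slice 0 Merge 0; Slice 0 Split 0]
      [:: Slice 0 Split 1; Slice 1 Merge 0]
| move_tI :
    reidemeister [:: Slice 0 Bar 0; Slice 0 Bar 0] [::]
| move_tII_l :
    reidemeister
      [:: Slice 0 Bar 1; Slice 0 (Cross Virtual) 0]
      [:: Slice 0 (Cross Virtual) 0; Slice 1 Bar 0]
| move_tII_r :
    reidemeister
      [:: Slice 1 Bar 0; Slice 0 (Cross Virtual) 0]
      [:: Slice 0 (Cross Virtual) 0; Slice 0 Bar 1]
(* On the right-hand side the two strands reach the classical crossing with
   their sides exchanged, so the same value of [b] puts the other strand over. *)
| move_tIII (b : bool) :
    reidemeister
      [:: Slice 0 Bar 1; Slice 1 Bar 0; Slice 0 (Cross (Classical b)) 0;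
          Slice 0 Bar 1; Slice 1 Bar 0]
      [:: Slice 0 (Cross Virtual) 0; Slice 0 (Cross (Classical b)) 0;
          Slice 0 (Cross Virtual) 0]
| move_tIV :
    reidemeister
      [:: Slice 0 Bar 0; Slice 0 Split 0; Slice 0 Bar 1; Slice 1 Bar 0]
      [:: Slice 0 Split 0; Slice 0 (Cross Virtual) 0]
| move_tV :
    reidemeister (pass_one_edge Virtual) (pass_two_edges Virtual).

(* A local picture with [l] further strands to its left and [r] to its right. *)
Definition pad (l r : nat) (w : seq slice) : seq slice :=
  [seq Slice (l + lft s) (elt s) (rgt s + r) | s <- w].

Definition replaces (R : seq slice -> seq slice -> Prop) (D D' : diagram) :
    Prop :=
  exists (u v : seq slice) (l r : nat) (w w' : seq slice),
    [/\ R w w', slices D = u ++ pad l r w ++ v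
      & slices D' = u ++ pad l r w' ++ v].

Definition move (D D' : diagram) : Prop :=
  replaces isotopy D D' \/ replaces reidemeister D D'.

Definition related : diagram -> diagram -> Prop :=
  clos_refl_sym_trans diagram move.

(* The twisted virtual handlebody-link represented by a diagram, as the
   equivalence class of that diagram. *)
Definition handlebody_link (D : diagram) : set diagram :=
  [set D' | related D D']%classic.

(* Main.v *)
Require Import Defs.
From mathcomp Require Import all_boot.
From mathcomp Require Import boolp classical_sets functions cardinality.
From mathcomp Require Import generic_quotient zify.
From Stdlib Require Import Relation_Operators.

(* Reading a diagram from bottom to top, a coloring is the same thing as the
   sequence of color lists found along the successive levels, two consecutive
   lists being related by the rule of the slice in between.  Under this
   correspondence a move changes only the part of the sequence that runs through
   the replaced local picture.  So it suffices that, for each move, the two local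
   pictures allow the same pairs of (bottom, top) color lists, and that each
   allowed pair is realized by exactly one interior coloring.  Both facts are
   local and follow from the axioms of a twisted virtual bikeigebra. *)

Set Implicit Arguments.
Unset Strict Implicit.
Unset Printing Implicit Defensive.

(** * Bijections from relations, and splitting of lists *)

Local Open Scope card_scope.

(** Between [A] and [B], [R] is the graph of a bijection, and choice extracts its two directions.
    Nothing here asks for finiteness, so infinite sets of colorings are covered. *)
Lemma card_eq_rel (T U : Type) (A : set T) (B : set U) (R : T -> U -> Prop) :
  (forall x, A x -> exists2 y, B y & R x y) ->
  (forall y, B y -> exists2 x, A x & R x y) ->
  (forall x y y', A x -> B y -> B y' -> R x y -> R x y' -> y = y') ->
  (forall x x' y, A x -> A x' -> B y -> R x y -> R x' y -> x = x') ->
  A #= B.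
Proof.
move=> totl totr fun_R inj_R.
have [f fP] : {f : A -> B & forall a, R (val a) (val (f a))}.
  apply: (@choice _ _ (fun (a : A) (b : B) => R (val a) (val b))) => -[x Ax].
  have [y By Rxy] := totl x (set_mem Ax).
  by exists (SigSub (mem_set By)).
have [g gP] : {g : B -> A & forall b, R (val (g b)) (val b)}.
  apply: (@choice _ _ (fun (b : B) (a : A) => R (val a) (val b))) => -[y By].
  have [x Ax Rxy] := totr y (set_mem By).
  by exists (SigSub (mem_set Ax)).
apply/card_bijP; exists f; exists g => [a|b]; apply: val_inj.
- by apply: (inj_R _ _ (val (f a))) => //; apply: set_mem (valP _).
- by apply: (fun_R (val (g b))) => //; apply: set_mem (valP _).
Qed.

Lemma onth_take (T : Type) n (s : seq T) i :
  onth (take n s) i = if i < n then onth s i else None.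
Proof. by elim: s n i => [|x s IHs] [|n] [|i] //=; rewrite ?if_same ?IHs. Qed.

Lemma onth_drop (T : Type) n (s : seq T) i : onth (drop n s) i = onth s (n + i).
Proof. by elim: s n => [|x s IHs] [|n] //=; rewrite ?onth0n. Qed.

Lemma cat_inj_size (T : Type) (u v u' v' : seq T) :
  size u = size u' -> u ++ v = u' ++ v' -> u = u' /\ v = v'.
Proof.
elim: u u' => [|x u IHu] [|x' u'] //= [su] [<- e].
by have [<- <-] := IHu _ su e.
Qed.

Lemma cat_inj_sizer (T : Type) (u v u' v' : seq T) :
  size v = size v' -> u ++ v = u' ++ v' -> u = u' /\ v = v'.
Proof.
move=> sv e; apply: cat_inj_size (e).
by apply/eqP; rewrite -(eqn_add2r (size v)) {2}sv -!size_cat e.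
Qed.

(** * Colorings as sequences of levels *)

Section Trajectories.

Variable X : tvBikeigebra.
Implicit Types (s : slice) (w : seq slice) (c d : seq X) (p : seq (seq X)).

(* Unlike [piece_rule], this also equates the two ends of a cup or a cap. *)
Definition ends_rule (g : piece) (bot top : seq X) : Prop :=
  match g, bot, top with
  | Cup, [::], [:: x; y] => x = y
  | Cap, [:: x; y], [::] => x = y
  | Cross t, [:: bl; br], [:: tl; tr] => crossing_rule t bl br tl tr
  | Bar, [:: x], [:: y] => y = twist x
  | Defs.Split, [:: b], [:: tl; tr] => tl *? tr = Some b
  | Merge, [:: bl; br], [:: t] => t *? br = Some bl
  | _, _, _ => False
  end.

(** The [take] and [drop] form matches [joined_in] position by position; [step_cat] and [step_catP]
    translate it into a splitting of both levels into left strands, ends of the piece and right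
    strands. *)
Definition step s c d : Prop :=
  [/\ size c = below s, size d = above s, take (lft s) c = take (lft s) d,
      drop (lft s + ends_below (elt s)) c = drop (lft s + ends_above (elt s)) d
    & ends_rule (elt s) (take (ends_below (elt s)) (drop (lft s) c))
                        (take (ends_above (elt s)) (drop (lft s) d))].

(* [p] lists the colors of the successive levels strictly above the level
   colored by [c]. *)
Fixpoint colored c w p : Prop :=
  match w, p with
  | [::], [::] => True
  | s :: w', d :: p' => step s c d /\ colored d w' p'
  | _, _ => False
  end.

Lemma size_ends_rule g b t :
  ends_rule g b t -> size b = ends_below g /\ size t = ends_above g.
Proof.
by case: g => [||?|||]; case: b => [|?[|?[|??]]]; case: t => [|?[|?[|??]]].
Qed.

(** The two alternatives at a bar coincide because [twist] is an involution. The equalities at cups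
    and caps use [onth], which asks for no default color. *)
Lemma ends_ruleP g b t :
  ends_rule g b t <->
  [/\ piece_rule g b t, (if g is Cup then onth t 0 = onth t 1 else True)
    & (if g is Cap then onth b 0 = onth b 1 else True)].
Proof.
case: g => [||?|||]; case: b => [|?[|?[|??]]]; case: t => [|?[|?[|??]]] /=;
  split=> //; try by move=> [].
- by move->.
- by case=> _ [].
- by move->.
- by case=> _ _ [].
- by move->; split=> //; eexists; left.
- by case=> -[x [[-> ->]|[-> ->]]] _ _ //; rewrite twistK.
Qed.

Lemma step_cat s (L b t R : seq X) :
  size L = lft s -> size R = rgt s -> ends_rule (elt s) b t ->
  step s (L ++ b ++ R) (L ++ t ++ R).
Proof.
move=> sL sR r; have [sb st] := size_ends_rule r.
split; rewrite /below /above ?size_cat ?sL ?sR ?sb ?st ?addnA //.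
- by rewrite -sL !take_size_cat.
- rewrite !(addnC (lft s)) -!drop_drop !(drop_size_cat _ sL).
  by rewrite (drop_size_cat _ sb) (drop_size_cat _ st).
- by rewrite !(drop_size_cat _ sL) (take_size_cat _ sb) (take_size_cat _ st).
Qed.

Lemma step_catP s c d : step s c d ->
  exists L b t R, [/\ c = L ++ b ++ R, d = L ++ t ++ R, size L = lft s,
    size R = rgt s & ends_rule (elt s) b t].
Proof.
case=> sc sd etake edrop r.
exists (take (lft s) c), (take (ends_below (elt s)) (drop (lft s) c)),
  (take (ends_above (elt s)) (drop (lft s) d)),
  (drop (lft s + ends_below (elt s)) c).
split=> //.
- by rewrite addnC -drop_drop !cat_take_drop.
- by rewrite etake edrop addnC -drop_drop !cat_take_drop.
- by rewrite size_takel // sc /below -addnA leq_addr.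
- by rewrite size_drop sc /below addKn.
Qed.

Lemma size_step s c d : step s c d -> size c = below s /\ size d = above s.
Proof. by case. Qed.

(** This makes a level sequence constant along semiarcs. An arc of the slice has its ends on level
    [k], colored by [c], or [k.+1], colored by [d], so the tests on [k] select the right list. *)
Lemma step_joined s (c d : seq X) k i j i' j' :
  step s c d -> joined_in s k i j i' j' ->
  onth (if i == k then c else d) j = onth (if i' == k then c else d) j'.
Proof.
case=> sc sd etake edrop /ends_ruleP[_ rcup rcap].
have kS : (k.+1 == k) = false by lia.
case/or3P=> [/and4P[/eqP-> /eqP-> jl /eqP->]|/and4P[/eqP-> /eqP-> lj /eqP e]|].
- rewrite kS eqxx.
  by have := congr1 (fun u => onth u j) etake; rewrite !onth_take jl.
- rewrite kS eqxx.
  have := congr1 (fun u => onth u (j - (lft s + ends_below (elt s)))) edrop.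
  by rewrite !onth_drop; congr (onth _ _ = onth _ _); lia.
- case E: (elt s) => //=; rewrite ?orbF //=;
    case/and4P=> /eqP-> /eqP-> /eqP-> /eqP->.
  + rewrite kS.
    by move: rcup; rewrite E !onth_take !onth_drop /= addn0 addn1.
  + rewrite eqxx.
    by move: rcap; rewrite E !onth_take !onth_drop /= addn0 addn1.
Qed.

Definition pad_slice l r s : slice := Slice (l + lft s) (elt s) (rgt s + r).

(** The added strands run straight through, so their colors reappear unchanged on the upper
    level. *)
Lemma step_pad s (L R : seq X) c e :
  step (pad_slice (size L) (size R) s) (L ++ c ++ R) e <->
  exists2 d, e = L ++ d ++ R & step s c d.
Proof.
split=> [|[_ -> /step_catP[L1 [b [t [R1 [-> -> sL1 sR1 r]]]]]]]; last first.
  rewrite -!catA !(catA L).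
  by apply: step_cat => //; rewrite size_cat ?sL1 ?sR1.
move=> st; have [sc _ _ _ _] := st.
case/step_catP: st => L1 [b [t [R1 [eL -> /= sL1 sR1 r]]]].
have [sb _] := size_ends_rule r.
move: sc; rewrite /below /= !size_cat => sc.
(* The strands left of the piece begin with those of [L], so [L1] is cut after [size L]; likewise
   [R1] is cut after [rgt s]. *)
move: eL; rewrite -[L1](cat_take_drop (size L)) -!catA.
case/cat_inj_size => [|eL].
  by rewrite size_takel // sL1 leq_addr.
rewrite -[R1](cat_take_drop (rgt s)) !catA.
have sR : size R = size (drop (rgt s) R1) by rewrite size_drop sR1 addKn.
move=> /(cat_inj_sizer sR)[ec eR].
exists (drop (size L) L1 ++ t ++ take (rgt s) R1).
  by rewrite -eL -eR !catA.
rewrite ec -catA; apply: step_cat => //; first by rewrite size_drop sL1 addKn.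
by rewrite size_takel // sR1 leq_addr.
Qed.

Lemma colored_pad w (L R : seq X) c p :
  colored (L ++ c ++ R) (pad (size L) (size R) w) p <->
  exists2 q, p = [seq L ++ d ++ R | d <- q] & colored c w q.
Proof.
elim: w c p => [|s w IHw] c [|e p] /=.
- by split=> // _; exists [::].
- by split=> // -[[|? ?]].
- by split=> // -[[|? ?]].
split=> [[/step_pad[d -> cd] /IHw[q -> cq]]|[[//|d q] /= [-> ->] [cd cq]]].
  by exists (d :: q).
by split; [apply/step_pad; exists d | apply/IHw; exists q].
Qed.

Lemma size_colored c w p : colored c w p -> size p = size w.
Proof.
by elim: w c p => [|s w IHw] c [|d p] //= [_ /IHw->].
Qed.

Lemma colored_cat c w1 w2 p1 p2 : size p1 = size w1 ->
  colored c (w1 ++ w2) (p1 ++ p2) <->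
  colored c w1 p1 /\ colored (last c p1) w2 p2.
Proof.
elim: w1 c p1 => [|s w IHw] c [|d p] //=; first by split=> [|[]].
by case=> /IHw IH; split=> [[? /IH[]]|[[? ?] ?]] //; split=> //; apply/IH.
Qed.

Lemma colored_catP c w1 w2 p : colored c (w1 ++ w2) p ->
  exists p1 p2, [/\ p = p1 ++ p2, size p1 = size w1, colored c w1 p1
    & colored (last c p1) w2 p2].
Proof.
move=> cp; have sp := size_colored cp.
have s1 : size (take (size w1) p) = size w1.
  by rewrite size_takel // sp size_cat leq_addr.
move: cp; rewrite -{1}(cat_take_drop (size w1) p).
case/(colored_cat _ _ _ s1)=> c1 c2.
by exists (take (size w1) p), (drop (size w1) p); rewrite cat_take_drop.
Qed.

(** Serves to recover the number of strands below a replaced picture from the well-formedness of the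
    whole diagram. *)
Lemma tangle_colored c w1 w2 n p : colored c w1 p ->
  tangle (size c) (w1 ++ w2) n -> tangle (size (last c p)) w2 n.
Proof.
elim: w1 c p => [|s w IHw] c [|d p] //= [/size_step[_ sd] cp] /andP[_].
by rewrite -sd; exact: IHw.
Qed.

Lemma coloredP c w p :
  colored c w p <->
  size p = size w /\
  forall k, k < size w ->
    step (nth (Slice 0 Cup 0) w k) (nth [::] (c :: p) k) (nth [::] p k).
Proof.
elim: w c p => [|s w IHw] c [|d p] //=; try by split=> // -[].
split=> [[cd /IHw[-> h]]|[[sp] h]].
  by split=> // -[|k] //= /h.
by split; [exact: (h 0) | apply/IHw; split=> // k /(h k.+1)].
Qed.

Lemma tangle_below m w n k : tangle m w n -> k < size w ->
  below (nth (Slice 0 Cup 0) w k) = nth 0 (m :: [seq above s | s <- w]) k.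
Proof.
elim: w m k => [|s w IHw] m [|k] //= /andP[/eqP sm tw] //.
by rewrite ltnS => /(IHw _ _ tw).
Qed.

End Trajectories.

(** * Bijection between colorings and level sequences *)

Section Colorings.

Variables (X : tvBikeigebra) (D : diagram).

Lemma size_level_colors (T : Type) (f : semiarc D -> T) (i : 'I_(size D).+1) :
  size (level_colors f i) = width D i.
Proof. by rewrite size_map size_enum_ord. Qed.

Lemma onth_level_colors (T : Type) (f : semiarc D -> T) (i : 'I_(size D).+1)
    (j : 'I_(width D i)) :
  onth (level_colors f i) j = Some (f (semiarc_of (mk_level_point j))).
Proof.
rewrite onth_map; have -> : onth (enum 'I_(width D i)) j = Some j.
  by rewrite onthE (nth_map j) ?size_enum_ord // nth_ord_enum.
by [].
Qed.

(** Level 0 has no points; [p] starts at level 1, and the leading [[::]] restores the missing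
    entry. *)
Definition levels_of (T : Type) (f : semiarc D -> T) (p : seq (seq T)) : Prop :=
  forall i : 'I_(size D).+1, level_colors f i = nth [::] ([::] :: p) i.

Lemma joined_semiarc (p q : level_point D) :
  joined p q -> semiarc_of p = semiarc_of q.
Proof.
by move=> pq; apply/eqmodP; apply: connect1; rewrite /link pq.
Qed.

Lemma level_colors_joined (T : Type) (f : semiarc D -> T) k
    (i i' : 'I_(size D).+1) j j' :
  k < size D -> j < width D i -> j' < width D i' ->
  joined_in (nth (Slice 0 Cup 0) D k) k i j i' j' ->
  onth (level_colors f i) j = onth (level_colors f i') j'.
Proof.
move=> kD jw jw' h.
rewrite (onth_level_colors f (Ordinal jw)) (onth_level_colors f (Ordinal jw')).
congr (Some (f _)); apply: joined_semiarc.
by apply/existsP; exists (Ordinal kD).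
Qed.

Lemma width_below k : k < size D ->
  width D k = below (nth (Slice 0 Cup 0) D k).
Proof. by move=> kD; rewrite (tangle_below (slicesP D) kD). Qed.

Lemma width_above k : k < size D ->
  width D k.+1 = above (nth (Slice 0 Cup 0) D k).
Proof. by move=> kD; rewrite /width /= (nth_map (Slice 0 Cup 0)). Qed.

(** [is_coloring] provides only the rule of the piece; the equalities along side strands, cups and
    caps hold because the points concerned lie on one semiarc. *)
Lemma coloring_step (f : semiarc D -> X) (k : 'I_(size D)) :
  is_coloring f ->
  step (nth (Slice 0 Cup 0) D k) (level_colors f (widen_ord (leqnSn _) k))
    (level_colors f (lift ord0 k)).
Proof.
move=> /(_ k) /=.
set s := nth _ _ _; set c := level_colors f _; set d := level_colors f _ => r.
have sc : size c = below s by rewrite size_level_colors -width_below.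
have sd : size d = above s by rewrite size_level_colors -width_above.
have J := @level_colors_joined X f k _ _ _ _ (ltn_ord k).
have wc : width D (widen_ord (leqnSn (size D)) k) = size c.
  by rewrite size_level_colors.
have wd : width D (lift ord0 k) = size d by rewrite size_level_colors.
have Jcd j j' := J (widen_ord (leqnSn _) k) (lift ord0 k) j j'.
have Jcc j j' := J (widen_ord (leqnSn _) k) (widen_ord (leqnSn _) k) j j'.
have Jdd j j' := J (lift ord0 k) (lift ord0 k) j j'.
rewrite wc wd -/s -/c -/d in Jcd; rewrite wc -/s -/c in Jcc.
rewrite wd -/s -/d in Jdd.
split=> //.
- apply: eq_from_onth => j; rewrite !onth_take; case: ifP => // jl.
  apply: Jcd; rewrite ?sc ?sd /below /above; try lia.
  by rewrite /joined_in /= /bump /= add1n jl !eqxx.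
- apply: eq_from_onth => j; rewrite !onth_drop.
  have [jr|jr] := ltnP j (rgt s); last first.
    by rewrite !onth_default // ?sc ?sd /below /above; lia.
  apply: Jcd; rewrite ?sc ?sd /below /above; try lia.
  by rewrite /joined_in /= /bump /= add1n !eqxx leq_addr; lia.
- apply/ends_ruleP; split=> //.
  + case E: (elt s) => //; rewrite !onth_take !onth_drop /=.
    apply: Jdd; rewrite ?sd /above ?E /=; try lia.
    by rewrite /joined_in E /= /bump /= add1n addn0 addn1 !eqxx !orbT.
  + case E: (elt s) => //; rewrite !onth_take !onth_drop /=.
    apply: Jcc; rewrite ?sc /below ?E /=; try lia.
    by rewrite /joined_in E /= addn0 addn1 !eqxx !orbT.
Qed.

Lemma coloring_levels (f : semiarc D -> X) : is_coloring f ->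
  exists2 p, colored [::] D p & levels_of f p.
Proof.
move=> col_f.
pose p := [seq level_colors f (lift ord0 k) | k <- enum 'I_(size D)].
have lp : levels_of f p.
  move=> i; case: (unliftP ord0 i) => [k|] ->.
    rewrite lift0 /= (nth_map (k : 'I_(size D))) ?size_enum_ord //.
    by rewrite nth_ord_enum.
  by apply: size0nil; rewrite size_level_colors.
exists p => //; apply/coloredP; split; first by rewrite size_map size_enum_ord.
move=> k kD; have := coloring_step (Ordinal kD) col_f.
by rewrite !lp.
Qed.

(** A point receives the color at its position in [p]. This is constant along each arc by
    [step_joined], hence along chains of arcs, and so descends to semiarcs. *)
Lemma levels_coloring p : colored (X := X) [::] D p ->
  exists2 f : semiarc D -> X, is_coloring f & levels_of f p.
Proof.
case/coloredP=> sp steps.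
pose lv k := nth [::] ([::] :: p) k.
have size_lv k : k <= size D -> size (lv k) = width D k.
  case: k => [|k] // kD; have [_ ->] := size_step (steps _ kD).
  by rewrite width_above.
(* Valued in [option X], since [X] may be empty and offer no default. *)
pose val (q : level_point D) := onth (lv (tag q)) (tagged q).
have val_joined q q' : joined q q' -> val q = val q'.
  case/existsP=> k h; have := step_joined (steps _ (ltn_ord k)) h.
  rewrite /val.
  have tq : tag q = k :> nat \/ tag q = k.+1 :> nat.
    move: h; rewrite /joined_in; case: (elt _) => * ; lia.
  have tq' : tag q' = k :> nat \/ tag q' = k.+1 :> nat.
    move: h; rewrite /joined_in; case: (elt _) => * ; lia.
  have kS : (k.+1 == k :> nat) = false by lia.
  move: (nat_of_ord (tagged q)) (nat_of_ord (tagged q')) => j j'.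
  by case: tq tq' => -> [] ->; rewrite ?kS ?eqxx.
have val_same q q' : same_semiarc q q' -> val q = val q'.
  case/connectP=> t; elim: t q => [|r t IHt] q /= => [_ -> //|/andP[qr rt] e].
  rewrite -(IHt r rt e).
  by case/orP: qr => [/val_joined|/val_joined/esym].
have val_some q : val q.
  by rewrite /val onthTE size_lv ?ltn_ord // -ltnS ltn_ord.
have [f fP] : {f : semiarc D -> X & forall a, val (repr a) = Some (f a)}.
  apply: (@choice _ _ (fun a x => val (repr a) = Some x)) => a.
  by case: (val (repr a)) (val_some (repr a)) => // x _; exists x.
have levf : levels_of f p.
  move=> i; apply: eq_from_onth => j.
  have [jw|jw] := ltnP j (width D i); last first.
    by rewrite !onth_default ?size_level_colors ?size_lv // -ltnS.
  rewrite (onth_level_colors f (Ordinal jw)) -fP.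
  transitivity (val (mk_level_point (Ordinal jw))); last by [].
  by apply: val_same; apply/eqmodP; rewrite reprK.
exists f => // k; have := steps _ (ltn_ord k).
by rewrite /= !levf lift0 => -[_ _ _ _ /ends_ruleP[]].
Qed.

(** A coloring determines all levels; conversely the levels determine the coloring, as every semiarc
    is the class of a level point. *)
Lemma card_colorings :
  colorings X D #= [set p | colored (X := X) [::] D p]%classic.
Proof.
apply: (@card_eq_rel _ _ _ _ (@levels_of X)) => /=.
- exact: coloring_levels.
- exact: levels_coloring.
- move=> f p p' _ /size_colored sp /size_colored sp' fp fp'.
  apply: (@eq_from_nth _ [::]) => [|k]; rewrite ?sp ?sp' // => kD.
  have kD' : k.+1 < (size D).+1 by [].
  exact: etrans (esym (fp (Ordinal kD'))) (fp' (Ordinal kD')).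
- move=> f f' p _ _ _ fp fp'; apply: funext; elim/quotW => -[i j].
  have /(congr1 (fun u => onth u j)) : level_colors f i = level_colors f' i.
    by rewrite fp fp'.
  by rewrite !onth_level_colors => -[].
Qed.

End Colorings.

(** * Local replacements *)

Section Replacement.

Variable X : tvBikeigebra.
Implicit Types (s : slice) (u v w : seq slice) (c d : seq X).
Implicit Types (p q : seq (seq X)).

(** With the end colors kept, the colorings of [w] inject into those of [w']: the first clause gives
    an image, and the second, about [w] alone, gives injectivity. Asked in both directions, this
    yields a bijection. *)
Definition embeds n w w' : Prop := forall c, size c = n ->
  (forall p, colored c w p ->
     exists2 q, colored c w' q & last c q = last c p) /\
  (forall p q, colored c w p -> colored c w q -> last c p = last c q -> p = q).

Lemma embeds_pad n w w' l r :
  embeds n w w' -> embeds (l + n + r) (pad l r w) (pad l r w').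
Proof.
move=> ww' c sc.
pose L := take l c; pose c0 := take n (drop l c); pose R := drop (l + n) c.
have ec : c = L ++ c0 ++ R by rewrite /R addnC -drop_drop !cat_take_drop.
have sL : size L = l by rewrite size_takel // sc -addnA leq_addr.
have sR : size R = r by rewrite size_drop sc addKn.
have sc0 : size c0 = n.
  by rewrite size_takel // size_drop sc -addnA addKn leq_addr.
have [tot det] := ww' c0 sc0.
have injf : injective (fun d : seq X => L ++ d ++ R).
  move=> d d' /cat_inj_size[//|_ e].
  by have [] := cat_inj_sizer (erefl (size R)) e.
rewrite ec -sL -sR; split=> [p /colored_pad[q -> cq]|p q].
  have [q' cq' lq'] := tot q cq.
  exists [seq L ++ d ++ R | d <- q']; first by apply/colored_pad; exists q'.
  by rewrite !(last_map (fun d => L ++ d ++ R)) lq'.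
move=> /colored_pad[p' -> cp'] /colored_pad[q' -> cq'].
by rewrite !(last_map (fun d => L ++ d ++ R)) => /injf/(det _ _ cp' cq') ->.
Qed.

(** The correspondence of level sequences across a replacement. The nested [last] is the top level
    of the local picture, or its bottom level when the picture is empty. *)
Definition matched u w w' p p' : Prop := exists p1 q q' p2,
  [/\ p = p1 ++ q ++ p2, p' = p1 ++ q' ++ p2, size p1 = size u,
      size q = size w /\ size q' = size w'
    & last (last [::] p1) q = last (last [::] p1) q'].

Lemma matched_sym u w w' p p' : matched u w w' p p' -> matched u w' w p' p.
Proof.
by case=> p1 [q [q' [p2 [? ? ? [? ?] ?]]]]; exists p1, q', q, p2.
Qed.

Lemma matched_total n u v w w' p :
  (forall p1, colored (X := X) [::] u p1 -> size (last [::] p1) = n) ->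
  embeds n w w' -> colored [::] (u ++ w ++ v) p ->
  exists2 p', colored [::] (u ++ w' ++ v) p' & matched u w w' p p'.
Proof.
move=> szu ww' /colored_catP[p1 [_ [-> s1 c1]]]
  /colored_catP[q [p2 [-> sq cq c2]]].
have [/(_ q cq)[q' cq' lq'] _] := ww' _ (szu _ c1).
exists (p1 ++ q' ++ p2); last first.
  by exists p1, q, q', p2; rewrite lq' (size_colored cq').
apply/(colored_cat _ _ _ s1); split=> //.
by apply/(colored_cat _ _ _ (size_colored cq')); rewrite lq'.
Qed.

(** Both sequences agree with [p] outside the picture and at its ends; the second clause of
    [embeds n w' w] then identifies their interiors. *)
Lemma matched_fun n u v w w' p p' p'' :
  (forall p1, colored (X := X) [::] u p1 -> size (last [::] p1) = n) ->
  embeds n w' w -> colored [::] (u ++ w' ++ v) p' ->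
  colored [::] (u ++ w' ++ v) p'' ->
  matched u w w' p p' -> matched u w w' p p'' -> p' = p''.
Proof.
move=> szu ww' cp' cp'' [p1 [q [q' [p2 [-> e' s1 [sq sq'] lq]]]]].
case=> r1 [t [t' [r2 [e e'' s1' [st st'] lt]]]].
have [e1 e23] : p1 = r1 /\ q ++ p2 = t ++ r2.
  by apply: cat_inj_size; rewrite ?s1 ?s1'.
have [e2 e3] : q = t /\ p2 = r2 by apply: cat_inj_size; rewrite ?sq ?st.
move: e'' lt; rewrite -{}e1 -{}e2 -{}e3 => e'' lt.
move: cp' cp''; rewrite e' e''.
case/(colored_cat _ _ _ s1)=> c1 /(colored_cat _ _ _ sq')[cq' _].
case/(colored_cat _ _ _ s1)=> _ /(colored_cat _ _ _ st')[ct' _].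
have [_ det] := ww' _ (szu _ c1).
by rewrite (det _ _ cq' ct') -?lq.
Qed.

Lemma card_colored_replace n u v w w' :
  (forall p1, colored (X := X) [::] u p1 -> size (last [::] p1) = n) ->
  embeds n w w' -> embeds n w' w ->
  [set p | colored (X := X) [::] (u ++ w ++ v) p]%classic
    #= [set p | colored (X := X) [::] (u ++ w' ++ v) p]%classic.
Proof.
move=> szu ww' w'w; apply: (card_eq_rel (R := matched u w w')) => /=.
- move=> p; exact: matched_total szu ww'.
- move=> p' /(matched_total szu w'w)[p cp m].
  by exists p => //; exact: matched_sym.
- move=> p p' p'' _; exact: matched_fun szu w'w.
- move=> p p' p'' cp cp' _ /matched_sym m /matched_sym m'.
  exact: matched_fun szu ww' cp cp' m m'.
Qed.

(** The right-hand picture of a move may be empty, so the number of lower ends is read off the first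
    slice of [w], which must exist. *)
Definition equicolored w w' : Prop :=
  let n := if w is s :: _ then below s else 0 in
  [/\ w <> [::], embeds n w w' & embeds n w' w].

Lemma card_colorings_replaces (R : seq slice -> seq slice -> Prop) D D' :
  (forall w w', R w w' -> equicolored w w') ->
  replaces R D D' -> colorings X D #= colorings X D'.
Proof.
move=> RE [u [v [l [r [w [w' [/RE[wn0 ww' w'w] eD eD']]]]]]].
apply: card_eq_trans (card_colorings X D) _.
rewrite card_eq_sym; apply: card_eq_trans (card_colorings X D') _.
rewrite card_eq_sym eD eD'.
apply: card_colored_replace (embeds_pad ww') (embeds_pad w'w).
(* The first slice of the padded picture tells how many strands the level reached after [u] has. *)
move=> p1 cp1; have := slicesP D.
rewrite eD => /(tangle_colored cp1).
case: w wn0 {ww' w'w eD} => [//|s w] _ /= /andP[/eqP <- _].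
by rewrite /below /=; lia.
Qed.

End Replacement.

(** * Crossings *)

Section Crossings.

Variable X : tvBikeigebra.
Implicit Types (x y z : X) (t : crossing).

(** Together with [cross_tr], this turns a crossing into a map from its lower to its upper colors,
    the switch map of the biquandle literature. *)
Definition cross_tl t x y : X :=
  match t with
  | Classical true => y *_ x | Classical false => y *^ x | Virtual => y *@ x
  end.

Definition cross_tr t x y : X :=
  match t with
  | Classical true => x *^ y | Classical false => x *_ y | Virtual => x *@ y
  end.

Lemma crossing_ruleE t (bl br tl tr : X) :
  crossing_rule t bl br tl tr <->
  tl = cross_tl t bl br /\ tr = cross_tr t bl br.
Proof. by case: t => [[]|] /=; split=> -[]. Qed.

Lemma flipK : involutive flip.
Proof. by case=> [[]|]. Qed.

(** The switch maps of [t] and [flip t] are inverse to each other, which is the algebra behind the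
    bigon moves. Each identity below combines an exchange axiom with an involution axiom. *)
Lemma cross_flip t x y :
  cross_tl (flip t) (cross_tl t x y) (cross_tr t x y) = x /\
  cross_tr (flip t) (cross_tl t x y) (cross_tr t x y) = y.
Proof.
have uo a b : (a *_ b) *_ (b *^ a) = a.
  by rewrite -(bk_over_under b a) bk_under_over bk_underK.
have ou a b : (a *^ b) *^ (b *_ a) = a.
  by rewrite -(bk_under_over b a) bk_over_under bk_overK.
have vv a b : (a *@ b) *@ (b *@ a) = a.
  by rewrite -(bk_virt_virt b a) bk_virt_virt bk_virtK.
by case: t => [[]|] /=.
Qed.

(** Exchanging bottom and top makes the rising strand a falling one, hence [flip]; this lets colors
    propagate downwards. *)
Lemma crossing_rule_flip t (bl br tl tr : X) :
  crossing_rule t bl br tl tr <-> crossing_rule (flip t) tl tr bl br.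
Proof.
have fl t' (a b c d : X) :
    crossing_rule t' a b c d -> crossing_rule (flip t') c d a b.
  move=> /crossing_ruleE[-> ->]; apply/crossing_ruleE.
  by have [-> ->] := cross_flip t' a b.
by split=> [/fl|/fl]; rewrite ?flipK.
Qed.

(** A counterclockwise quarter turn, needed when a strand passes a local extremum. *)
Lemma crossing_rule_rot t (bl br tl tr : X) :
  crossing_rule t bl br tl tr <-> crossing_rule (flip t) tl bl tr br.
Proof.
have rot t' (a b c d : X) :
    crossing_rule t' a b c d -> crossing_rule (flip t') c a d b.
  case: t' => [[]|] /= -[-> ->].
  - by rewrite bk_underK bk_over_under.
  - by rewrite bk_overK bk_under_over.
  - by rewrite bk_virtK bk_virt_virt.
(* The converse consists of three more quarter turns, completing a full one. *)
by split=> [/rot //|/rot/rot/rot]; rewrite !flipK.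
Qed.

Definition cross12 t (v : X * X * X) : X * X * X :=
  let: (x, y, z) := v in (cross_tl t x y, cross_tr t x y, z).
Definition cross23 t (v : X * X * X) : X * X * X :=
  let: (x, y, z) := v in (x, cross_tl t y z, cross_tr t y z).

Lemma cross12K t : cancel (cross12 t) (cross12 (flip t)).
Proof. by case=> -[x y] z /=; have [-> ->] := cross_flip t x y. Qed.

Lemma cross23K t : cancel (cross23 t) (cross23 (flip t)).
Proof. by case=> -[x y] z /=; have [-> ->] := cross_flip t y z. Qed.

Lemma cross12VK t : cancel (cross12 (flip t)) (cross12 t).
Proof. by move=> v; rewrite -{1}[t]flipK cross12K. Qed.

Lemma cross23VK t : cancel (cross23 (flip t)) (cross23 t).
Proof. by move=> v; rewrite -{1}[t]flipK cross23K. Qed.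

(** The set-theoretic Yang-Baxter equation, with types attached to pairs of strands: the two sides
    read [triangle_l] and [triangle_r] from bottom to top. *)
Definition yang_baxter t12 t13 t23 : Prop := forall v,
  cross12 t23 (cross23 t13 (cross12 t12 v)) =
  cross23 t12 (cross12 t13 (cross23 t23 v)).

(* The braid relation can be conjugated by a crossing; this reduces the variants
   of the triangle moves to [FFF], [FVV] and [VVV]. *)
Lemma yang_baxter_l t12 t13 t23 :
  yang_baxter t12 t13 t23 -> yang_baxter t13 t12 (flip t23).
Proof.
move=> yb v; apply: (can_inj (cross12K t23)).
by rewrite yb cross12VK cross23VK.
Qed.

Lemma yang_baxter_r t12 t13 t23 :
  yang_baxter t12 t13 t23 -> yang_baxter (flip t12) t23 t13.
Proof.
move=> yb v; apply: (can_inj (cross23K t12)).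
by rewrite -yb cross12VK cross23VK.
Qed.

(** Up to a change of variables, the three coordinates are the three exchange laws [bk_ooo],
    [bk_uou] and [bk_uuu]. *)
Lemma yang_baxter_FFF :
  yang_baxter (Classical false) (Classical false) (Classical false).
Proof.
case=> -[x y] z /=.
have e3 : (x *_ y) *_ z = (x *_ (z *^ y)) *_ (y *_ z).
  by have := bk_uuu x (z *^ y) y; rewrite (bk_under_over y z); rewrite bk_overK.
congr (_, _, _) => //.
(* With [a = x *_ y], the color [y *^ x] is [y *^ a], so [bk_ooo] applies, and [a *_ y] is again
   [x]. *)
- by rewrite -(bk_over_under y x) bk_ooo bk_underK.
- by rewrite -(bk_over_under y x) -bk_uou e3 bk_over_under.
Qed.

Lemma yang_baxter_FVV : yang_baxter (Classical false) Virtual Virtual.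
Proof.
case=> -[x y] z /=.
have e3 : (x *_ y) *@ z = (x *@ (z *@ y)) *_ (y *@ z).
  by have := bk_uvv x y (z *@ y); rewrite bk_virtK bk_virt_virt.
congr (_, _, _) => //.
- by rewrite -(bk_over_under y x) bk_vvo bk_underK.
- by rewrite -(bk_over_under y x) bk_ovv e3 bk_over_under.
Qed.

Lemma yang_baxter_VVV : yang_baxter Virtual Virtual Virtual.
Proof.
case=> -[x y] z /=.
have e3 : (x *@ y) *@ z = (x *@ (z *@ y)) *@ (y *@ z).
  by have := bk_vvv x y (z *@ y); rewrite bk_virtK bk_virt_virt.
congr (_, _, _) => //.
- by rewrite -(bk_virt_virt y x) bk_vvv bk_virtK.
- by rewrite -(bk_virt_virt y x) bk_vvv e3 bk_virt_virt.
Qed.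

End Crossings.

(** * Equality of end colors *)

Section Rigidity.

Variable X : tvBikeigebra.
Implicit Types (s : slice) (w : seq slice) (c d : seq X) (p q : seq (seq X)).

(** The color of a cup is free, and the lower color of a split does not fix its two upper ones. *)
Definition determined_upwards s :=
  match elt s with Cup | Defs.Split => false | _ => true end.
Definition determined_downwards s :=
  match elt s with Cap | Merge => false | _ => true end.

Lemma step_upwards s c d d' :
  determined_upwards s -> step s c d -> step s c d' -> d = d'.
Proof.
move=> us /step_catP[L [b [t [R [ec -> sL sR r]]]]].
case/step_catP=> L' [b' [t' [R' [ec' -> sL' sR' r']]]].
have [sb _] := size_ends_rule r; have [sb' _] := size_ends_rule r'.
move: ec'; rewrite ec => /cat_inj_size[|<- /cat_inj_size[|eb <-]].
- by rewrite sL.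
- by rewrite sb.
congr (_ ++ _ ++ _); move: us r r'; rewrite /determined_upwards -eb.
case: (elt s) b {sb sb' eb ec} => [||k|||] [|x[|y[|z b]]] // _;
  case: t => [|tl [|tr [|? t]]] //; case: t' => [|tl' [|tr' [|? t']]] //=.
- by move=> /crossing_ruleE[-> ->] /crossing_ruleE[-> ->].
- by move=> -> ->.
(* Rotating the product at a merge exhibits its upper color as the value of a product of the two
   lower ones. *)
- by move=> /bk_prod_rot1 e /bk_prod_rot1; rewrite e => -[->].
Qed.

Lemma step_downwards s c c' d :
  determined_downwards s -> step s c d -> step s c' d -> c = c'.
Proof.
move=> us /step_catP[L [b [t [R [-> ed sL sR r]]]]].
case/step_catP=> L' [b' [t' [R' [-> ed' sL' sR' r']]]].
have [_ st] := size_ends_rule r; have [_ st'] := size_ends_rule r'.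
move: ed'; rewrite ed => /cat_inj_size[|<- /cat_inj_size[|et <-]].
- by rewrite sL.
- by rewrite st.
congr (_ ++ _ ++ _); move: us r r'; rewrite /determined_downwards -et.
case: (elt s) t {st st' et ed} => [||k|||] [|x[|y[|z t]]] // _;
  case: b => [|bl [|br [|? b]]] //; case: b' => [|bl' [|br' [|? b']]] //=.
- move=> /crossing_rule_flip/crossing_ruleE[-> ->].
  by move=> /crossing_rule_flip/crossing_ruleE[-> ->].
- by move=> -> /(can_inj (@twistK X)) ->.
- by move=> -> [->].
Qed.

(* [w] has at most one coloring with given end colors.  A picture in which the
   colors can be propagated in a single vertical direction is rigid. *)
Definition rigid n w : Prop := forall c p q, size c = n ->
  colored c w p -> colored c w q -> last c p = last c q -> p = q.

Lemma rigid_upwards n w : all determined_upwards w -> rigid n w.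
Proof.
move=> uw c p q _ cp cq _.
elim: w c p q uw cp cq => [|s w IHw] c [|d p] [|e q] //=.
case/andP=> us uw [cd cp] [ce cq].
by move: cq; rewrite -(step_upwards us cd ce) => /(IHw _ _ _ uw cp) ->.
Qed.

Lemma rigid_downwards n w : all determined_downwards w -> rigid n w.
Proof.
move=> dw c p q _ cp cq lpq.
(* Propagation from the top also recovers the bottom level, so the induction starts from an
   arbitrary [c'] and proves that it equals [c]. *)
suff [] : c = c /\ p = q by [].
have: forall c' q, colored c' w q -> last c p = last c' q -> c = c' /\ p = q.
  elim: w dw c p cp {cq lpq} => [|s w IHw] dw c [|d p] //=.
    by move=> _ c' [|? ?].
  case/andP: dw => ds dw [cd cp] c' [|d' q'] //= [cd' cq'] l.
  have [edd ->] := IHw dw d p cp d' q' cq' l.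
  by move: cd'; rewrite -edd => /(step_downwards ds cd) ->.
by apply.
Qed.

Fixpoint reaches c w d : Prop :=
  if w is s :: w' then exists2 e, step s c e & reaches e w' d else c = d.

Lemma reachesP c w d :
  reaches c w d <-> exists2 p, colored c w p & last c p = d.
Proof.
elim: w c => [|s w IHw] c /=; first by split=> [->|[[|]]//]; exists [::].
split=> [[e ce /IHw[p cp <-]]|[[//|e p] /= [ce cp] l]].
  by exists (e :: p).
by exists e => //; apply/IHw; exists p.
Qed.

(** Splits each move into two independent tasks: the interior colors are unique on each side, and
    both sides relate the same end colors. *)
Lemma equicolored_reaches n w w' :
  n = (if w is s :: _ then below s else 0) -> w <> [::] ->
  rigid n w -> rigid n w' ->
  (forall c d, size c = n -> reaches c w d <-> reaches c w' d) ->
  equicolored X w w'.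
Proof.
move=> en wn0 rw rw' ends; split=> // c; rewrite -en => sc.
- split=> [p cp|p q]; last exact: rw.
  have /(ends _ _ sc)/reachesP[q cq lq] : reaches c w (last c p).
    by apply/reachesP; exists p.
  by exists q.
- split=> [p cp|p q]; last exact: rw'.
  have /(ends _ _ sc)/reachesP[q cq lq] : reaches c w' (last c p).
    by apply/reachesP; exists p.
  by exists q.
Qed.

End Rigidity.

(** * Tactics for pictures with explicit colors *)

Arguments crossing_rule : simpl never.

(** The length of each level is computed from its slice, so the lists of colors can be destructed
    into individual colors. *)
Ltac invert_levels :=
  repeat match goal with
  | H : reaches _ (_ :: _) _ |- _ => destruct H as [? ? H]
  | H : reaches _ [::] _ |- _ => simpl in H; subst
  | H : colored _ (_ :: _) ?p |- _ =>
      destruct p as [|? p]; [destruct H|destruct H as [? H]]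
  | H : colored _ [::] ?p |- _ => destruct p as [|? p]; [clear H|destruct H]
  | H : step ?s _ ?e |- _ =>
      let sz := fresh "sz" in let et := fresh "et" in
      let ed := fresh "ed" in let r := fresh "r" in
      destruct H as [_ sz et ed r];
      let n := eval vm_compute in (above s) in change (size e = n) in sz
  | sz : size ?e = S _ |- _ =>
      destruct e as [|? e]; [discriminate sz|simpl in sz; injection sz as sz]
  | sz : size ?e = 0 |- _ => destruct e as [|? e]; [clear sz|discriminate sz]
  end; simpl in * |-;
  repeat match goal with
  | H : _ :: _ = _ :: _ |- _ => injection H; clear H; intros; subst
  | H : [::] = [::] |- _ => clear H
  | H : _ = _ :> carrier _ |- _ => progress subst
  end.

Ltac compute_crossings :=
  repeat match goal with
  | H : crossing_rule _ _ _ _ _ |- _ =>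
      apply crossing_ruleE in H; destruct H; subst
  end.

Ltac solve_ends_rule :=
  simpl; first
    [ exact erefl | eassumption | apply -> crossing_rule_rot; eassumption
    | apply <- crossing_rule_rot; eassumption
    | apply/crossing_ruleE; split; reflexivity | idtac ].

Tactic Notation "climb" uconstr(l) :=
  refine (ex_intro2 _ _ l _ _);
    [split; [reflexivity|reflexivity|simpl; reflexivity|simpl; reflexivity|
             solve_ends_rule]|].

Ltac climb_levels :=
  repeat match goal with
  | |- reaches _ (?s :: _) _ => hnf
  | |- ex2 (fun e => step ?s _ e) _ =>
      let n := eval vm_compute in (above s) in
      match n with
      | 0 => climb [::]
      | 1 => climb [:: _]
      | 2 => climb [:: _; _]
      | 3 => climb [:: _; _; _]
      end
  end; simpl.

(** What remains is the rigidity of pictures in which colors propagate in neither direction, and the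
    two inclusions between the relations on end colors. *)
Ltac compare_levels n :=
  apply: (equicolored_reaches (n := n)) => //;
    try exact: rigid_upwards; try exact: rigid_downwards;
    try (intros c d sc; split; intros h; invert_levels).

Ltac invert_trajectories := intros c p q sc cp cq l; invert_levels.

(** * Moves *)

Section Isotopy.

Variable X : tvBikeigebra.

Lemma pprod_rot (x y z : X) : x *? y = Some z -> y *? z = Some x.
Proof. by move/bk_prod_rot1. Qed.

Lemma equicolored_exchange g h m : equicolored X
  [:: Slice 0 g (m + ends_below h); Slice (ends_above g + m) h 0]
  [:: Slice (ends_below g + m) h 0; Slice 0 g (m + ends_above h)].
Proof.
set w := (X in equicolored _ X); set w' := (X in equicolored _ _ X).
(* The common relation on end colors: [g] acts on the left block, [h] on the right block, and the
   [m] strands between them pass through. *)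
pose exchanged (c d : seq X) := exists b t M b' t',
  [/\ c = b ++ M ++ b', d = t ++ M ++ t', size M = m, ends_rule g b t
    & ends_rule h b' t'].
have wP c d : reaches c w d <-> exchanged c d.
  split=> [[e /step_catP[L [b [t [R [-> -> /size0nil-> /= sR r]]]]]]|].
    case=> f /step_catP[L' [b' [t' [R' [eL -> /= sL' /size0nil eR' r']]]]] <-.
    have [_ st] := size_ends_rule r.
    (* The strands left of [h] are the upper ends of [g] followed by the [m] strands in between. *)
    move: eL; rewrite eR' -[L'](cat_take_drop (size t)) -!catA !cats0.
    case/cat_inj_size => [|et ->].
      by rewrite size_takel // sL' st leq_addr.
    exists b, t, (drop (size t) L'), b', t'; split=> //.
      by rewrite -et.
    by rewrite size_drop sL' st addKn.
  case=> b [t [M [b' [t' [-> -> sM r r']]]]].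
  have [sb st] := size_ends_rule r; have [sb' st'] := size_ends_rule r'.
  exists (t ++ M ++ b').
    by apply: (@step_cat _ _ [::]); rewrite //= size_cat sM sb'.
  exists (t ++ M ++ t') => //; rewrite !catA -[b']cats0 -[t']cats0.
  by apply: step_cat; rewrite //= size_cat st sM.
have w'P c d : reaches c w' d <-> exchanged c d.
  split=> [[e /step_catP[L' [b' [t' [R' [-> -> /= sL' /size0nil-> r']]]]]]|].
    case=> f /step_catP[L [b [t [R [eL -> /size0nil eL0 /= sR r]]]]] <-.
    have [sb _] := size_ends_rule r.
    move: eL; rewrite eL0 -[L'](cat_take_drop (size b)) -!catA !cats0 !cat0s.
    case/cat_inj_size => [|eb <-].
      by rewrite size_takel // sL' sb leq_addr.
    exists b, t, (drop (size b) L'), b', t'; split=> //.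
      by rewrite {1}eb.
    by rewrite size_drop sL' sb addKn.
  case=> b [t [M [b' [t' [-> -> sM r r']]]]].
  have [sb st] := size_ends_rule r; have [sb' st'] := size_ends_rule r'.
  exists (b ++ M ++ t').
    rewrite !catA -[b']cats0 -[t']cats0.
    by apply: step_cat; rewrite //= size_cat sb sM.
  exists (t ++ M ++ t') => //.
  by apply: (@step_cat _ _ [::]); rewrite //= size_cat sM st'.
apply: equicolored_reaches (erefl _) _ _ _ _ => //; last first.
- by move=> c d _; rewrite wP w'P.
- move=> c p q _ cp cq.
  case: p cp (size_colored cp) => [|e [|d []]] // [s1 [s2 _]] _.
  case: q cq (size_colored cq) => [|e' [|d' []]] // [s1' [s2' _]] _ /= ed.
  move: s1 s2 s1' s2'; rewrite -{}ed /step /=.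
  move=> [_ _ et _ _] [_ _ _ ed _] [_ _ et' _ _] [_ _ _ ed' _].
  (* The middle level of [w'] is glued from known parts: its first [ends_below g] colors come from
     the level below, the others from the level above. For [w] the two sources are exchanged. *)
  congr [:: _; _]; rewrite -(cat_take_drop (ends_below g) e) [drop _ e]ed -ed'.
  rewrite -(take_takel e (leq_addr m _)) -et et' take_takel ?leq_addr //.
  by rewrite cat_take_drop.
- move=> c p q _ cp cq.
  case: p cp (size_colored cp) => [|e [|d []]] // [s1 [s2 _]] _.
  case: q cq (size_colored cq) => [|e' [|d' []]] // [s1' [s2' _]] _ /= ed.
  move: s1 s2 s1' s2'; rewrite -{}ed /step /=.
  move=> [_ _ _ ed _] [_ _ et _ _] [_ _ _ ed' _] [_ _ et' _ _].
  congr [:: _; _]; rewrite -(cat_take_drop (ends_above g) e) -[drop _ e]ed ed'.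
  rewrite -(take_takel e (leq_addr m _)) et -et' take_takel ?leq_addr //.
  by rewrite cat_take_drop.
Qed.

(** Crossings pass an extremum by a quarter turn, and bending an edge at a vertex rotates its
    product cyclically. *)
Lemma equicolored_isotopy w w' : isotopy w w' -> equicolored X w w'.
Proof.
case=> [||g h m|t|t||||||].
- by compare_levels 1; climb_levels => //; first by invert_trajectories.
- by compare_levels 1; climb_levels => //; first by invert_trajectories.
- exact: equicolored_exchange.
- by compare_levels 3; climb_levels.
- by compare_levels 1; climb_levels.
- by compare_levels 2; climb_levels; rewrite ?twistK.
- compare_levels 0.
  (* Ends [twist x] and [x] arise from a cup colored [x] with its bar on the left, or colored
     [twist x] with its bar on the right. *)
  + by climb [:: twist _; _]; climb [:: _; _]; rewrite /= twistK.
  + by climb [:: twist _; _]; climb [:: _; _]; rewrite /= twistK.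
- compare_levels 2; climb_levels => //; first by invert_trajectories.
  + by first [apply: pprod_rot; assumption | do 2 apply: pprod_rot; assumption].
  + by first [apply: pprod_rot; assumption | do 2 apply: pprod_rot; assumption].
- by compare_levels 2; climb_levels => //; first by invert_trajectories.
- compare_levels 1; climb_levels => //; first by invert_trajectories.
  + by first [apply: pprod_rot; assumption | do 2 apply: pprod_rot; assumption].
  + by first [apply: pprod_rot; assumption | do 2 apply: pprod_rot; assumption].
- by compare_levels 1; climb_levels => //; first by invert_trajectories.
Qed.

End Isotopy.

(** * Reidemeister moves *)

Section Reidemeister.

Variable X : tvBikeigebra.
Implicit Types (x y z : X) (t : crossing).

(** The equation for the loop color [x] has exactly one solution, thanks to [bk_diag] in the
    classical cases. The claim [loop] treats all types at once, [op] and [op'] being the operations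
    that produce [d] and [x]. *)
Lemma kink_rule t (a x d : X) :
  crossing_rule t a x d x <-> d = a /\ x = cross_tr t a a.
Proof.
have loop (op op' : X -> X -> X) : (forall u v, op u (op' v u) = op u v) ->
    (forall u v, op' u (op v u) = op' u v) ->
    (forall u v, op (op u v) v = u) -> (forall u v, op' (op' u v) v = u) ->
    (forall u, op u u = op' u u) ->
    (d = op x a /\ x = op' a x) <-> (d = a /\ x = op' a a).
  move=> opop' op'op opK op'K diag; split=> -[-> ex]; last first.
    by split; rewrite ex -diag ?opK ?op'op.
  (* Here [op x a = op x x = op' x x = op' (op' a x) x = a]. *)
  have xa : op x a = a by rewrite -opop' -ex diag {1}ex op'K.
  by rewrite xa; split=> //; rewrite -diag -{1}xa opK.
case: t => [[]|].
- apply: (loop (@under_op X) (@over_op X)).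
  + exact: bk_under_over.
  + exact: bk_over_under.
  + exact: bk_underK.
  + exact: bk_overK.
  + exact: bk_diag.
- rewrite /crossing_rule /= and_comm; apply: (loop (@over_op X) (@under_op X)).
  + exact: bk_over_under.
  + exact: bk_under_over.
  + exact: bk_overK.
  + exact: bk_underK.
  + by move=> u; rewrite bk_diag.
- rewrite /crossing_rule /= and_comm; apply: (loop (@virt_op X) (@virt_op X)).
  + exact: bk_virt_virt.
  + exact: bk_virt_virt.
  + exact: bk_virtK.
  + exact: bk_virtK.
  + by [].
Qed.

Lemma cross_flipV t x y :
  cross_tl t (cross_tl (flip t) x y) (cross_tr (flip t) x y) = x /\
  cross_tr t (cross_tl (flip t) x y) (cross_tr (flip t) x y) = y.
Proof. by have := cross_flip (flip t) x y; rewrite flipK. Qed.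

Lemma cross_tlK t x : involutive (cross_tl t x).
Proof.
by case: t => [[]|] y /=; rewrite ?bk_underK ?bk_overK ?bk_virtK.
Qed.

Lemma prod_cross b x y :
  x *? y = cross_tl (Classical b) x y *? cross_tr (Classical b) x y.
Proof. by case: b => /=; rewrite -?bk_prod_ou -?bk_prod_uo. Qed.

Lemma prod_cross_tl t x y z :
  omap (cross_tl t x) (y *? z) =
  cross_tl t x y *? cross_tl t (cross_tr t x y) z.
Proof.
by case: t => [[]|] /=; rewrite -?bk_prod_under -?bk_prod_over -?bk_prod_virt.
Qed.

Lemma cross_tr_prod t x y z yz : y *? z = Some yz ->
  cross_tr t x yz = cross_tr t (cross_tr t x y) z.
Proof.
move=> e; case: t => [[]|] /=.
- exact: bk_over_prod.
- exact: bk_under_prod.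
- exact: bk_virt_prod.
Qed.

Lemma twist_prod x y z :
  twist x *? twist y = Some (twist z) <->
  cross_tl Virtual x y *? cross_tr Virtual x y = Some z.
Proof.
rewrite -bk_twist_prod; split=> [-> /=|]; first by rewrite twistK.
by case: (twist x *? twist y) => //= u [<-]; rewrite twistK.
Qed.

(** The existential form matches the IH-move: the intermediate product is the color of the inner
    edge on either side. *)
Lemma pprodA x y z w :
  (exists2 u, x *? y = Some u & u *? z = Some w) <->
  (exists2 u, y *? z = Some u & x *? u = Some w).
Proof.
have := bk_prodA x y z.
case: (x *? y) => [u|]; case: (y *? z) => [v|] /= e.
- split=> -[_ [<-] h]; first by exists v; rewrite // -e.
  by exists u; rewrite // e.
- by split=> -[] // _ [<-]; rewrite e.
- by split=> -[] // _ [<-]; rewrite -e.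
- by split=> -[].
Qed.

Lemma equicolored_kink t : equicolored X (kink t) [::].
Proof.
rewrite /kink; compare_levels 1.
- invert_trajectories.
  repeat match goal with H : crossing_rule _ _ _ _ _ |- _ =>
    apply kink_rule in H; destruct H; subst end.
  by [].
- by move: r0 => /kink_rule[->].
- climb [:: _; cross_tr t c c; cross_tr t c c].
  climb [:: c; cross_tr t c c; cross_tr t c c]; first exact/kink_rule.
  by climb [:: _].
Qed.

Lemma equicolored_bigon t : equicolored X (bigon t) [::].
Proof.
rewrite /bigon; compare_levels 2; compute_crossings; climb_levels.
- by have [-> ->] := cross_flip t c4 c5.
- by have [-> ->] := cross_flip t c c0.
Qed.

Lemma equicolored_triangle t12 t13 t23 : yang_baxter X t12 t13 t23 ->
  equicolored X (triangle_l t12 t13 t23) (triangle_r t12 t13 t23).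
Proof.
rewrite /triangle_l /triangle_r => yb.
compare_levels 3; compute_crossings; climb_levels.
- by have /= [-> -> ->] := yb (c9, c10, c8).
- by have /= [-> -> ->] := yb (c6, c10, c11).
Qed.

Lemma equicolored_rV t : equicolored X (pass_one_edge t) (pass_two_edges t).
Proof.
rewrite /pass_one_edge /pass_two_edges; compare_levels 2; compute_crossings.
(* The edge colors before the transversal passes, found by undoing its action on [c0] and [c1];
   [cross_tl] with a fixed first argument is an involution. *)
- pose p := cross_tl t c5 c0; pose q := cross_tl t (cross_tr t c5 p) c1.
  have pq : p *? q = Some c6.
    have := prod_cross_tl t c5 p q; rewrite !cross_tlK r.
    by case: (p *? q) => //= u [/(inv_inj (cross_tlK t c5)) ->].
  climb [:: c5; p; q]; climb [:: _; _; _]; climb [:: _; _; _].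
  by rewrite /reaches -(cross_tr_prod t c5 pq) !cross_tlK.
- climb [:: _; _].
  climb [:: cross_tl t c6 c7; cross_tl t (cross_tr t c6 c7) c5; _].
    by rewrite -prod_cross_tl r1.
  by rewrite (cross_tr_prod t c6 r1).
Qed.

Lemma equicolored_rVI :
  equicolored X
    [:: Slice 0 Merge 0; Slice 0 Defs.Split 0]
    [:: Slice 0 Defs.Split 1; Slice 1 Merge 0].
Proof.
(* In both pictures the color of the inner edge is the value of a product of end colors, hence
   unique. *)
compare_levels 2; try by invert_trajectories; congruence.
- have [x e1 e2] : exists2 x, c1 *? c4 = Some x & c0 *? x = Some c3.
    by apply/pprodA; eexists; eassumption.
  by climb [:: c0; x; c4]; climb [:: c0; c1].
- have [x e1 e2] : exists2 x, c0 *? c1 = Some x & x *? c4 = Some c5.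
    by apply/pprodA; eexists; eassumption.
  by climb [:: x]; climb [:: c0; c1].
Qed.

Lemma equicolored_tIV : equicolored X
  [:: Slice 0 Bar 0; Slice 0 Defs.Split 0; Slice 0 Bar 1; Slice 1 Bar 0]
  [:: Slice 0 Defs.Split 0; Slice 0 (Cross Virtual) 0].
Proof.
compare_levels 1; compute_crossings.
(* A virtual crossing is its own inverse: applied to the top colors, it gives the colors just above
   the vertex. *)
- climb [:: cross_tl Virtual (twist c4) (twist c3);
            cross_tr Virtual (twist c4) (twist c3)].
    by apply/twist_prod; rewrite !twistK.
  climb [:: _; _].
  by have [-> ->] := cross_flipV Virtual (twist c4) (twist c3).
- climb [:: _]; climb [:: twist (cross_tl Virtual c2 c3);
                          twist (cross_tr Virtual c2 c3)].
    by apply/twist_prod; have [-> ->] := cross_flip Virtual c2 c3.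
  by climb [:: _; _]; climb [:: _; _]; rewrite !twistK.
Qed.

Lemma equicolored_reidemeister w w' : reidemeister w w' -> equicolored X w w'.
Proof.
have fff := @yang_baxter_FFF X; have fft := yang_baxter_l fff.
have tff := yang_baxter_r fff; have ttf := yang_baxter_r fft.
have ftt := yang_baxter_l tff; have ttt := yang_baxter_l ttf.
have fvv := @yang_baxter_FVV X; have vfv := yang_baxter_l fvv.
have vvf := yang_baxter_r vfv; have vvt := yang_baxter_l vvf.
have vtv := yang_baxter_r vvt; have tvv := yang_baxter_l vtv.
case=> [b|b|b12 b13 b23 h||||b|b|b|b|b|||||b||].
- exact: equicolored_kink.
- exact: equicolored_bigon.
- by apply: equicolored_triangle; case: b12 b13 b23 h => [] [] [].
- exact: equicolored_kink.
- exact: equicolored_bigon.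
- exact: equicolored_triangle (@yang_baxter_VVV X).
- by apply: equicolored_triangle; case: b.
- by apply: equicolored_triangle; case: b.
- by apply: equicolored_triangle; case: b.
- compare_levels 1; compute_crossings.
  + climb [:: cross_tl (Classical b) c2 c3; cross_tr (Classical b) c2 c3] => //.
    by rewrite -prod_cross.
  (* The opposite crossing undoes the one to be added, and it too preserves the product. *)
  + climb [:: cross_tl (flip (Classical b)) c0 c1;
              cross_tr (flip (Classical b)) c0 c1].
      by rewrite -(prod_cross (~~ b)).
    climb [:: _; _].
    by have [-> ->] := cross_flipV (Classical b) c0 c1.
- exact: equicolored_rV.
- exact: equicolored_rVI.
- by compare_levels 1; climb_levels; rewrite twistK.
- by compare_levels 2; compute_crossings; climb_levels;
    rewrite bk_twist_virt -bk_virt_twist.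
- by compare_levels 2; compute_crossings; climb_levels;
    rewrite bk_twist_virt -bk_virt_twist.
- by compare_levels 2; compute_crossings; climb_levels; case: b => /=;
    rewrite bk_twist_under bk_twist_over.
- exact: equicolored_tIV.
- exact: equicolored_rV.
Qed.

End Reidemeister.

Lemma card_colorings_related (X : tvBikeigebra) (D D' : diagram) :
  related D D' -> colorings X D #= colorings X D'.
Proof.
elim=> {D D'} [D D' [] | D | D D' _ IH | D D' D'' _ IH _].
- exact/card_colorings_replaces/equicolored_isotopy.
- exact/card_colorings_replaces/equicolored_reidemeister.
- exact: card_eqxx.
- by rewrite card_eq_sym.
- exact: card_eq_trans.
Qed.

Theorem corollary2 (X : tvBikeigebra) (D D' : diagram) :
  (related D D' -> colorings X D #= colorings X D') /\
  (handlebody_link D = handlebody_link D' ->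
     colorings X D #= colorings X D').
Proof.
split=> [|eDD']; first exact: card_colorings_related.
apply: card_colorings_related; suff: handlebody_link D D' by [].
by rewrite eDD'; exact: rst_refl.
Qed.
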